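(* Let $(X,\rho)$ be a complete separable metric space satisfying the strict triangle inequality $\rho(x,y)<\rho(x,z)+\rho(z,y)$ for all $x,y,z\in X$ with $z\notin\{x,y\}$. If $\Phi\colon\mathcal{W}_1(X)\to\mathcal{W}_1(X)$ is an isometry (distance preserving bijection), then there exists an isometry $\psi$ of $X$ such that $\Phi(\mu)=\psi_\#\mu$ for all $\mu\in\mathcal{W}_1(X)$.
   Context: $\mathcal{W}_1(X)$ is the set of Borel probability measures $\mu$ on $X$ with $\int_X\rho(x,\hat x)\,d\mu(x)<\infty$ for some $\hat x\in X$, with $d_{\mathcal{W}_1}(\mu,\nu)=\inf_{\pi\in\Pi(\mu,\nu)}\int_{X\times X}\rho(x,y)\,d\pi(x,y)$, $\Pi(\mu,\nu)$ being the set of Borel probability measures on $X\times X$ with marginals $\mu,\nu$. The push-forward is $(g_\#\mu)(A)=\mu(g^{-1}[A])$. *)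

(* Defs.v *)
From HB Require Import structures.
From mathcomp Require Import all_boot all_order all_algebra.
From mathcomp Require Import all_classical all_reals all_analysis.
Set Implicit Arguments. Unset Strict Implicit. Unset Printing Implicit Defensive.
Import Order.TTheory GRing.Theory Num.Theory.
Local Open Scope classical_set_scope.
Local Open Scope ring_scope.

Section Defs.
Context {R : realType}.

Definition is_metric {T : Type} (rho : T -> T -> R) : Prop :=
  (forall x y, 0 <= rho x y) /\
  (forall x y, rho x y = 0 <-> x = y) /\
  (forall x y, rho x y = rho y x) /\
  (forall x y z, rho x y <= rho x z + rho z y).

Definition metric_complete {T : Type} (rho : T -> T -> R) : Prop :=
  forall u : nat -> T,
    (forall e, 0 < e -> exists N, forall m n, (N <= m)%N -> (N <= n)%N ->
       rho (u m) (u n) < e) ->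
    exists l, forall e, 0 < e -> exists N, forall n, (N <= n)%N -> rho (u n) l < e.

Definition metric_separable {T : Type} (rho : T -> T -> R) : Prop :=
  exists D : set T, countable D /\
    forall x e, 0 < e -> exists2 y, D y & rho x y < e.

Definition strict_triangle {T : Type} (rho : T -> T -> R) : Prop :=
  forall x y z, z <> x -> z <> y -> rho x y < rho x z + rho z y.

Definition rho_open {T : Type} (rho : T -> T -> R) : set (set T) :=
  [set A | forall x, A x -> exists2 e, 0 < e & [set y | rho x y < e] `<=` A].

Definition metric_isometry {T : Type} (rho : T -> T -> R) (psi : T -> T) : Prop :=
  bijective psi /\ forall x y, rho (psi x) (psi y) = rho x y.

Definition meas_eq {d} {T : measurableType d} (mu nu : set T -> \bar R) : Prop :=
  forall A, measurable A -> mu A = nu A.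

Local Open Scope ereal_scope.

Definition W1 {d} {T : measurableType d} (rho : T -> T -> R)
  : set (probability T R) :=
  [set mu | exists xh : T, \int[mu]_x (rho x xh)%:E < +oo].

Definition couplings {d} {T : measurableType d} (mu nu : probability T R)
  : set (probability (T * T)%type R) :=
  [set pi | forall A, measurable A ->
     pi (A `*` setT) = mu A /\ pi (setT `*` A) = nu A].

Definition dW1 {d} {T : measurableType d} (rho : T -> T -> R)
  (mu nu : probability T R) : \bar R :=
  ereal_inf [set \int[pi]_z (rho z.1 z.2)%:E | pi in couplings mu nu].

End Defs.

(* Main.v *)
Require Import Defs.
From HB Require Import structures.
From mathcomp Require Import all_boot all_order all_algebra.
From mathcomp Require Import all_classical all_reals all_analysis.
From mathcomp Require Import measurable_realfun lra.
Set Implicit Arguments. Unset Strict Implicit. Unset Printing Implicit Defensive.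
Import Order.TTheory GRing.Theory Num.Theory.
Local Open Scope classical_set_scope.
Local Open Scope ring_scope.

(**
Dirac measures are exactly the measures that are not strictly between two
others: the strict triangle inequality, applied to the product coupling, shows
that a Dirac measure is never strictly between two measures, while any other
measure is a proper mixture and hence lies on the segment between its two
components. So [Phi] permutes the Dirac measures, which yields [psi].

A two-point measure is determined by its distances to the two Dirac measures
at its support, so [Phi] acts on two-point measures through [psi].
For [x != y] and [nu_t = t delta_y + (1 - t) delta_x], the equality
[d(mu, nu_t) + d(nu_t, delta_x) = d(mu, delta_x)] holds iff [t <= mu {y}],
again by the strict triangle inequality. Hence [mu {y} <= (Phi mu) {psi y}],
which settles the case of a measure carried by a countable set, because the
masses of its atoms add up to 1. By separability such measures are dense.

Neither optimal couplings nor the triangle inequality for [dW1] are needed: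
a small [dW1] is exploited only through Markov's inequality for the distance
under an almost optimal coupling.
*)

(** * Mixtures, image measures, products and Markov's inequality *)

Section ProbabilityConstructions.
Context {R : realType} {d1 d2 : measure_display}.
Context {U : measurableType d1} {V : measurableType d2}.
Local Open Scope ereal_scope.

(** [mnormalize] divides by the total mass, here 1; its fallback [dirac point] concerns only the
    masses 0 and infinity. *)
Lemma probability_of_measure d (T : measurableType d)
    (m : {measure set T -> \bar R}) :
  m setT = 1 -> exists P : probability T R, forall A, P A = m A.
Proof.
move=> m1; exists (mnormalize m (dirac point)) => A /=.
by rewrite /mnormalize/= m1 onee_eq0/= invr1 mule1.
Qed.

Lemma probability_mixture (P Q : probability U R) (t : R) :
  (0 <= t <= 1)%R -> exists M : probability U R,
    (forall A, M A = t%:E * P A + (1 - t)%:E * Q A) /\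
    (forall f : U -> \bar R, measurable_fun setT f -> (forall x, 0 <= f x) ->
      \int[M]_x f x = t%:E * \int[P]_x f x + (1 - t)%:E * \int[Q]_x f x).
Proof.
move=> /andP[t0 t1]; have s0 : (0 <= 1 - t)%R by rewrite subr_ge0.
pose m := measure_add (mscale (NngNum t0) P) (mscale (NngNum s0) Q).
have mE A : m A = t%:E * P A + (1 - t)%:E * Q A by rewrite /m measure_addE.
have [|M ME] := @probability_of_measure _ _ m.
  by apply: etrans (mE _) _; rewrite !probability_setT !mule1 -EFinD addrC subrK.
exists M; split=> [A|f mf f0]; first exact: etrans (ME A) (mE A).
rewrite (@eq_measure_integral _ _ _ setT m M)//; last by move=> A _ _; exact: ME.
rewrite [LHS]ge0_integral_measure_add//; congr (_ + _); exact: ge0_integral_mscale.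
Qed.

Lemma probability_pushforward (P : probability U R) (phi : U -> V) :
  measurable_fun setT phi -> exists Q : probability V R,
    (forall A, Q A = P (phi @^-1` A)) /\
    (forall f : V -> \bar R, measurable_fun setT f -> (forall x, 0 <= f x) ->
      \int[Q]_y f y = \int[P]_x f (phi x)).
Proof.
move=> mphi.
pose X : {mfun U >-> V} := HB.pack phi (isMeasurableFun.Build _ _ _ _ _ mphi).
exists (distribution P X); split=> [A//|f mf f0].
by rewrite ge0_integral_distribution.
Qed.

Lemma measurable_set_ler (f g : U -> R) :
  measurable_fun setT f -> measurable_fun setT g ->
  measurable [set x | f x <= g x]%R.
Proof.
move=> mf mg.
have := measurable_fun_ler mf mg measurableT (Y := [set true]) I.
by rewrite setTI.
Qed.

(** Markov's inequality for [g - f]: the finite integral of [f] cancels from the hypothesis, so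
    [g - f] has integral at most [e]. *)
Lemma measure_gap_ge (P : {measure set U -> \bar R}) (f g : U -> R) (e c : R) :
  measurable_fun setT f -> measurable_fun setT g ->
  (forall x, 0 <= f x)%R -> (forall x, f x <= g x)%R ->
  \int[P]_x (f x)%:E < +oo ->
  \int[P]_x (g x)%:E <= \int[P]_x (f x)%:E + e%:E ->
  (0 < c)%R ->
  c%:E * P [set x | c <= g x - f x]%R <= e%:E.
Proof.
move=> mf mg f0 fg foo ge c0.
have mh : measurable_fun setT (fun x => (g x - f x)%:E).
  by apply/measurable_EFinP; exact: measurable_funB.
have h0 x : 0 <= (g x - f x)%:E by rewrite lee_fin subr_ge0.
have E : \int[P]_x (g x)%:E = \int[P]_x (f x)%:E + \int[P]_x (g x - f x)%:E.
  rewrite -ge0_integralD//; last exact/measurable_EFinP; last first.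
    by move=> x _; rewrite lee_fin.
  by apply: eq_integral => x _; rewrite -EFinD addrC subrK.
have ffin : \int[P]_x (f x)%:E \is a fin_num.
  by rewrite ge0_fin_numE//; apply: integral_ge0 => x _; rewrite lee_fin.
have he : \int[P]_x (g x - f x)%:E <= e%:E by move: ge; rewrite E leeD2lE.
apply: le_trans he.
rewrite [leRHS](_ : _ = \int[P]_x `|(g x - f x)%:E|); last first.
  by apply: eq_integral => x _; rewrite gee0_abs.
have := le_integral_abse P measurableT mh c0; apply: le_trans.
rewrite setTI lee_pmul2l ?lte_fin//.
rewrite [X in P X <= _](_ : _ = [set x | c%:E <= `|(g x - f x)%:E|])//.
by apply/seteqP; split=> x /=; rewrite lee_fin ger0_norm// subr_ge0.
Qed.

(** The set is the countable union of the sets where the gap is at least [1/(n+1)], each null by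
    Markov's inequality with [e = 0]. *)
Lemma measure_gap_eq0 (P : {measure set U -> \bar R}) (f g : U -> R) :
  measurable_fun setT f -> measurable_fun setT g ->
  (forall x, 0 <= f x)%R -> (forall x, f x <= g x)%R ->
  \int[P]_x (f x)%:E < +oo ->
  \int[P]_x (g x)%:E <= \int[P]_x (f x)%:E ->
  P [set x | f x < g x]%R = 0.
Proof.
move=> mf mg f0 fg foo ge.
have mS n : measurable [set x | n.+1%:R^-1 <= g x - f x]%R.
  by apply: measurable_set_ler => //; exact: measurable_funB.
have -> : [set x | f x < g x]%R = \bigcup_n [set x | n.+1%:R^-1 <= g x - f x]%R.
  apply/seteqP; split=> [x /= fgx|x [n _] /= h]; last first.
    by rewrite -subr_gt0; apply: lt_le_trans h; rewrite invr_gt0.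
  have h : (0 < g x - f x)%R by rewrite subr_gt0.
  exists (Num.truncn (g x - f x)^-1) => //=.
  rewrite invf_ple ?posrE//; apply/ltW/truncnS_gt.
apply: measure_negligible; first exact: bigcupT_measurable.
apply: negligible_bigcup => n; apply/negligibleP => //.
apply/eqP; rewrite eq_le measure_ge0 andbT.
have := @measure_gap_ge P f g 0 n.+1%:R^-1 mf mg f0 fg foo.
rewrite adde0 => /(_ ge); rewrite invr_gt0 ltr0n pmule_rle0 => [/(_ isT)//|].
by rewrite lte_fin invr_gt0.
Qed.

Lemma probability_product (P : probability U R) (Q : probability V R) :
  exists M : probability (U * V)%type R,
    forall A B, measurable A -> measurable B -> M (A `*` B) = P A * Q B.
Proof.
have [|M ME] := @probability_of_measure _ _ (P \x Q).
  rewrite -setXTT.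
  apply: etrans (product_measure1E P Q measurableT measurableT) _.
  by rewrite (congr2 mule (probability_setT P) (probability_setT Q)) mule1.
exists M => A B mA mB; apply: etrans (ME _) _.
exact: product_measure1E.
Qed.

End ProbabilityConstructions.

(** * Borel measurability in a separable metric space *)

Lemma exists_inv_lt (R : realType) (e : R) : 0 < e ->
  exists n : nat, n.+1%:R^-1 < e.
Proof.
move=> e0; exists (Num.truncn e^-1).
by rewrite invf_plt ?posrE// truncnS_gt.
Qed.

(** The points at distance at least [e] from the complement of [V]. This set is closed for every
    [V], hence Borel. *)
Definition shrink {R : realType} {T : Type} (rho : T -> T -> R) (V : set T)
    (e : R) : set T :=
  [set x | forall y, rho x y < e -> V y].

Section MetricMeasurability.
Context {R : realType} {d : measure_display} {T : measurableType d}.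
Context {rho : T -> T -> R}.
Context (hmetric : is_metric rho) (hsep : metric_separable rho).
Context (hborel : @measurable d T = <<s rho_open rho >>).

Lemma rho_ge0 x y : 0 <= rho x y. Proof. exact: hmetric.1. Qed.

Lemma rho_xx x : rho x x = 0. Proof. by apply/(hmetric.2.1 x x). Qed.

Lemma rho_sym x y : rho x y = rho y x. Proof. exact: hmetric.2.2.1. Qed.

Lemma rho_triangle z x y : rho x y <= rho x z + rho z y.
Proof. exact: hmetric.2.2.2. Qed.

Lemma rho_gt0 x y : x <> y -> 0 < rho x y.
Proof.
move=> xy; rewrite lt_neqAle rho_ge0 andbT; apply/eqP => e.
by apply/xy/(hmetric.2.1 x y).
Qed.

Lemma rho_open_measurable A : rho_open rho A -> measurable A.
Proof. by move=> oA; rewrite hborel; exact: sub_sigma_algebra. Qed.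

Lemma rho_open_ball x e : rho_open rho [set y | rho y x < e].
Proof.
move=> y /= yx; exists (e - rho y x); first by rewrite subr_gt0.
by move=> z /= yz; have := rho_triangle y z x; rewrite (rho_sym z y); lra.
Qed.

Lemma metric_measurable_set1 (x : T) : measurable [set x].
Proof.
rewrite -(setCK [set x]); apply/measurableC/rho_open_measurable => y /= yx.
by exists (rho y x); [exact: rho_gt0|move=> z /= + zx; rewrite zx ltxx].
Qed.

Lemma metric_dense_seq :
  exists s : nat -> T, forall x e, 0 < e -> exists k, rho x (s k) < e.
Proof.
have [D [/countable_injP[f finj] Ddense]] := hsep.
(* [f] is an injective coding of [D]. Numbers that code no point of [D] go to the default [point];
   extra terms do not spoil density. *)
exists (fun n => xget point [set y | D y /\ f y = n]) => x e e0.
have [y Dy xy] := Ddense x e e0; exists (f y).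
have [Ds fs] := @xgetPex _ point [set z | D z /\ f z = f y]
  (ex_intro _ y (conj Dy erefl)).
by rewrite (finj _ _ _ _ fs)// inE.
Qed.

(** The product sigma-algebra is generated by rectangles, so [rho < r] is written as a countable
    union of them: products of two balls about the same term of a dense sequence, with radii adding
    up to [r]. *)
Lemma measurable_metric : measurable_fun setT (fun z : T * T => rho z.1 z.2).
Proof.
have [s sdense] := metric_dense_seq.
apply: (measurability _ (RGenInftyO.measurableE R)) => _ [_ [r ->] <-].
rewrite setTI.
have -> : (fun z : T * T => rho z.1 z.2) @^-1` `]-oo, r[ =
  \bigcup_k \bigcup_n ([set y | rho y (s k) < n.+1%:R^-1] `*`
                       [set y | rho y (s k) < r - n.+1%:R^-1]).
  apply/seteqP; split=> [[a b] /=|[a b] [k _] [n _] /= []]; rewrite in_itv/=.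
    (* Half of the slack, because [1/(n+1)] is lost twice: in the radius of the second ball and on
       the way from [a] to [s k]. *)
    move=> abr; have h0 : 0 < (r - rho a b) / 2 by lra.
    have [n nh] := exists_inv_lt h0.
    have n0 : 0 < n.+1%:R^-1 :> R by rewrite invr_gt0.
    have [k ak] := sdense a _ n0.
    exists k => //; exists n => //; split=> //=.
    have := rho_triangle a b (s k); rewrite (rho_sym b a).
    by move: nh ak; move: n.+1%:R^-1 => i; lra.
  have := rho_triangle (s k) a b; rewrite (rho_sym (s k) b).
  by move: n.+1%:R^-1 => i; lra.
apply: bigcupT_measurable => k; apply: bigcupT_measurable => n.
by apply: measurableX; exact/rho_open_measurable/rho_open_ball.
Qed.

Lemma measurable_metric_l x : measurable_fun setT (fun z : T => rho z x).
Proof. exact: (measurable_fun_pair1 x measurable_metric). Qed.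

Lemma measurable_metric_comp {d'} {U : measurableType d'} (f g : U -> T) :
  measurable_fun setT f -> measurable_fun setT g ->
  measurable_fun setT (fun z => rho (f z) (g z)).
Proof.
move=> mf mg.
exact: (measurableT_comp measurable_metric (measurable_fun_pair mf mg)).
Qed.

Lemma measurable_shrink (V : set T) (e : R) : measurable (shrink rho V e).
Proof.
rewrite -(setCK (shrink rho V e)); apply/measurableC/rho_open_measurable => x /=.
move=> /existsNP[y] /not_implyP[xy Vy]; exists (e - rho x y).
  by rewrite subr_gt0.
move=> z /= xz; apply/existsNP; exists y; apply/not_implyP; split=> //.
by have := rho_triangle x z y; rewrite (rho_sym z x); lra.
Qed.

End MetricMeasurability.

(** * Couplings, distances to Dirac measures, and separation *)

Section Wasserstein.
Context {R : realType} {d : measure_display} {T : measurableType d}.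
Context {rho : T -> T -> R}.
Context (hmetric : is_metric rho) (hsep : metric_separable rho).
Context (hborel : @measurable d T = <<s rho_open rho >>).
Implicit Types mu nu : probability T R.

Let rho0 := rho_ge0 hmetric.
Let rhoC := rho_sym hmetric.
Let mrho : measurable_fun setT (fun z : T * T => rho z.1 z.2) :=
  measurable_metric hmetric hsep hborel.
Let mrhol x : measurable_fun setT (fun z : T => rho z x) :=
  measurable_metric_l hmetric hsep hborel x.
Local Open Scope ereal_scope.

Let erho0 x y : 0 <= (rho x y)%:E. Proof. by rewrite lee_fin. Qed.
Let emrho : measurable_fun setT (fun z : T * T => (rho z.1 z.2)%:E).
Proof. exact/measurable_EFinP. Qed.
Let emrhol x : measurable_fun setT (fun z : T => (rho z x)%:E).
Proof. exact/measurable_EFinP. Qed.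
Let mrho1 x : measurable_fun setT (fun z : T * T => rho z.1 x).
Proof. exact: (measurableT_comp (mrhol x) measurable_fst). Qed.
Let mrho2 x : measurable_fun setT (fun z : T * T => rho z.2 x).
Proof. exact: (measurableT_comp (mrhol x) measurable_snd). Qed.

Lemma coupling_integral_fst mu nu pi (f : T -> \bar R) :
  couplings mu nu pi -> measurable_fun setT f -> (forall x, 0 <= f x) ->
  \int[pi]_z f z.1 = \int[mu]_x f x.
Proof.
move=> cpi mf f0.
have [Q [QE QI]] := @probability_pushforward R _ _ _ T pi fst measurable_fst.
rewrite -QI//; apply: eq_measure_integral => A mA _.
apply: etrans (QE A) _; apply: etrans _ (cpi A mA).1; congr (pi _).
by apply/seteqP; split=> [z //|z []].
Qed.

Lemma coupling_integral_snd mu nu pi (f : T -> \bar R) :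
  couplings mu nu pi -> measurable_fun setT f -> (forall x, 0 <= f x) ->
  \int[pi]_z f z.2 = \int[nu]_x f x.
Proof.
move=> cpi mf f0.
have [Q [QE QI]] := @probability_pushforward R _ _ _ T pi snd measurable_snd.
rewrite -QI//; apply: eq_measure_integral => A mA _.
apply: etrans (QE A) _; apply: etrans _ (cpi A mA).2; congr (pi _).
by apply/seteqP; split=> [z //|z []].
Qed.

Lemma dW1_le_cost mu nu pi : couplings mu nu pi ->
  dW1 rho mu nu <= \int[pi]_z (rho z.1 z.2)%:E.
Proof. by move=> cpi; apply: ereal_inf_lbound; exists pi. Qed.

Lemma dW1_lower_bound mu nu c :
  (forall pi, couplings mu nu pi -> c <= \int[pi]_z (rho z.1 z.2)%:E) ->
  c <= dW1 rho mu nu.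
Proof. by move=> h; apply: le_ereal_inf_tmp => _ [pi cpi <-]; exact: h. Qed.

Lemma dW1_ge0 mu nu : 0 <= dW1 rho mu nu.
Proof. by apply: dW1_lower_bound => pi _; exact: integral_ge0. Qed.

Lemma eq_dW1 mu mu' nu nu' : meas_eq mu mu' -> meas_eq nu nu' ->
  dW1 rho mu nu = dW1 rho mu' nu'.
Proof.
move=> e1 e2; rewrite /dW1; congr (ereal_inf (image _ _)).
apply/seteqP; split=> pi cpi A mA.
  by rewrite -e1// -e2//; exact: cpi.
by rewrite e1// e2//; exact: cpi.
Qed.

(** The coupling is the law of [(f, g)] under [P]. Swapped and diagonal couplings, couplings with a
    Dirac measure and those of the final approximation arise in this way. *)
Lemma coupling_pushforward {d'} {U : measurableType d'} (P : probability U R)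
    (f g : U -> T) mu nu :
  measurable_fun setT f -> measurable_fun setT g ->
  (forall A, measurable A -> mu A = P (f @^-1` A)) ->
  (forall A, measurable A -> nu A = P (g @^-1` A)) ->
  exists pi, couplings mu nu pi /\
    \int[pi]_z (rho z.1 z.2)%:E = \int[P]_x (rho (f x) (g x))%:E.
Proof.
move=> mf mg muE nuE.
have [Q [QE QI]] := probability_pushforward P (measurable_fun_pair mf mg).
exists Q; split; last by rewrite QI.
move=> A mA; rewrite !QE muE// nuE//; split; congr (P _);
  by apply/seteqP; split=> [x [//]|x /= ?]; split.
Qed.

Lemma dW1_sym mu nu : dW1 rho mu nu = dW1 rho nu mu.
Proof.
suff H m n : dW1 rho m n <= dW1 rho n m by apply/eqP; rewrite eq_le !H.
apply: dW1_lower_bound => pi cpi.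
have [||A mA|A mA|pi' [cpi' E]] := @coupling_pushforward _ _ pi snd fst m n.
- exact: measurable_snd.
- exact: measurable_fst.
- by rewrite -(cpi A mA).2; congr (pi _); apply/seteqP; split=> [x []|x /=].
- by rewrite -(cpi A mA).1; congr (pi _); apply/seteqP; split=> [x []|x /=].
apply: le_trans (dW1_le_cost cpi') _; rewrite E le_eqVlt; apply/orP; left.
by apply/eqP/eq_integral => z _; rewrite rhoC.
Qed.

Lemma pdiracE (x : T) (A : set T) :
  (dirac x : probability T R) A = (x \in A)%:R%:E.
Proof. exact: diracE. Qed.

Lemma coupling_dirac mu x : exists2 pi, couplings mu (dirac x) pi &
  \int[pi]_z (rho z.1 z.2)%:E = \int[mu]_z (rho z x)%:E.
Proof.
have [||A mA|A mA|pi [cpi E]] :=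
  @coupling_pushforward _ _ mu id (cst x) mu (dirac x).
- exact: measurable_id.
- exact: measurable_cst.
- by rewrite preimage_id.
- rewrite preimage_cst pdiracE; case: ifPn => _; last by rewrite measure0.
  by rewrite probability_setT.
- by exists pi.
Qed.

(** For the lower bound, [rho z.2 x] has integral 0 under any coupling with [dirac x], and the
    triangle inequality bounds [rho z.1 x] by [rho z.1 z.2] plus this term. *)
Lemma dW1_dirac mu x : dW1 rho mu (dirac x) = \int[mu]_z (rho z x)%:E.
Proof.
apply/eqP; rewrite eq_le; apply/andP; split.
  by have [pi cpi <-] := coupling_dirac mu x; exact: dW1_le_cost.
apply: dW1_lower_bound => pi cpi.
rewrite -(coupling_integral_fst cpi)//.
have e0 : \int[pi]_z (rho z.2 x)%:E = 0.
  rewrite (coupling_integral_snd (f := fun z => (rho z x)%:E) cpi)//.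
  by rewrite integral_dirac// diracT mul1e (rho_xx hmetric).
rewrite -[leRHS]adde0 -e0 -ge0_integralD//; last by apply/measurable_EFinP.
apply: ge0_le_integral => //.
- exact/measurable_EFinP.
- by apply: emeasurable_funD => //; exact/measurable_EFinP.
- by move=> z _; rewrite -EFinD lee_fin; exact: (rho_triangle hmetric).
Qed.

Lemma dW1_dirac_l mu x : dW1 rho (dirac x) mu = \int[mu]_z (rho z x)%:E.
Proof. by rewrite dW1_sym dW1_dirac. Qed.

Lemma integral_rho_dirac x y : \int[dirac y]_z (rho z x)%:E = (rho y x)%:E.
Proof. by rewrite integral_dirac// diracT mul1e. Qed.

Lemma dW1_dirac_dirac x y : dW1 rho (dirac x) (dirac y) = (rho x y)%:E.
Proof. by rewrite dW1_dirac integral_rho_dirac. Qed.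

Lemma W1_dirac x : W1 rho (dirac x).
Proof. by exists x; rewrite integral_rho_dirac ltry. Qed.

Lemma integral_rho_le mu x y :
  \int[mu]_z (rho z x)%:E <= \int[mu]_z (rho z y)%:E + (rho y x)%:E.
Proof.
rewrite [leRHS](_ : _ = \int[mu]_z ((rho z y)%:E + (rho y x)%:E)).
  apply: ge0_le_integral => //.
  - exact: emeasurable_funD.
  - by move=> z _; rewrite -EFinD lee_fin; exact: (rho_triangle hmetric).
by rewrite ge0_integralD// integral_cst//= probability_setT mule1.
Qed.

Lemma W1_integral_lty mu x : W1 rho mu -> \int[mu]_z (rho z x)%:E < +oo.
Proof.
move=> [y yoo]; apply: le_lt_trans (integral_rho_le mu x y) _.
by rewrite lte_add_pinfty// ltry.
Qed.

Lemma coupling_diag mu : exists2 pi, couplings mu mu pi &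
  \int[pi]_z (rho z.1 z.2)%:E = 0.
Proof.
have [||||pi [cpi E]] := @coupling_pushforward _ _ mu id id mu mu => //.
exists pi => //; rewrite E/=.
by rewrite integral0_eq// => z _; rewrite (rho_xx hmetric).
Qed.

Lemma dW1xx mu : dW1 rho mu mu = 0.
Proof.
apply/eqP; rewrite eq_le dW1_ge0 andbT.
by have [pi cpi <-] := coupling_diag mu; exact: dW1_le_cost.
Qed.

(** Under a coupling of cost below [e], pairs at distance at least [c] have mass at most [e / c] by
    Markov's inequality; every other pair that starts in the shrunken set ends in [V]. *)
Lemma dW1_shrink mu nu (V : set T) (e c : R) : dW1 rho mu nu < e%:E ->
  (0 < c)%R -> measurable V ->
  mu (shrink rho V c) <= nu V + (e / c)%:E.
Proof.
move=> /ereal_inf_lt[_ [pi cpi <-] pie] c0 mV.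
have mS := measurable_shrink hmetric hborel V c.
have mc : measurable [set z : T * T | c <= rho z.1 z.2]%R.
  by apply: measurable_set_ler => //; exact: measurable_cst.
rewrite -(cpi _ mS).1 -(cpi _ mV).2.
apply: (@le_trans _ _ (pi ((setT `*` V) `|` [set z : T * T | c <= rho z.1 z.2]%R))).
  apply: le_measure; rewrite ?inE//.
  - exact: measurableX.
  - by apply: measurableU => //; exact: measurableX.
  - move=> [a b] /= [Sa _].
    have [|ab] := leP c (rho a b); first by right.
    by left; split=> //=; exact: Sa.
apply: le_trans (measureU2 _ _ _) _ => //; first exact: measurableX.
rewrite leeD2l// EFinM lee_pdivlMr//.
rewrite muleC.
have := @measure_gap_ge R _ (T * T)%type pi (cst 0%R) (fun z => rho z.1 z.2) e c.
under [X in _ * pi X]eq_set => z do rewrite subr0.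
apply=> //; rewrite integral0 ?ltry// add0e; exact: ltW.
Qed.

(** Two shrinkings, because measures will be compared through an intermediate one and each passage
    costs one shrinking. *)
Lemma rho_open_bigcup_shrink (V : set T) : rho_open rho V ->
  V = \bigcup_n shrink rho (shrink rho V n.+1%:R^-1) n.+1%:R^-1.
Proof.
move=> oV; apply/seteqP; split=> [x Vx|x [n _]]; last first.
  have n0 : (0 < n.+1%:R^-1 :> R)%R by rewrite invr_gt0.
  move=> /(_ x); rewrite (rho_xx hmetric) => /(_ n0 x).
  by rewrite (rho_xx hmetric); exact.
have [e e0 eV] := oV x Vx.
have [|n ne] := @exists_inv_lt R (e / 2); first lra.
exists n => // y xy z yz; apply: eV => /=.
apply: le_lt_trans (rho_triangle hmetric y x z) _.
by move: ne xy yz; move: n.+1%:R^-1%R => i; lra.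
Qed.

(** Chaining [dW1_shrink] through [gamma] and exhausting an open set from inside compares the two
    measures on open sets, which are a generating family stable under intersection. *)
Lemma meas_eq_of_dW1_approx mu nu :
  (forall e : R, (0 < e)%R -> exists gamma : probability T R,
    dW1 rho mu gamma < e%:E /\ dW1 rho gamma nu < e%:E) ->
  meas_eq mu nu.
Proof.
move=> H.
have le_open m n (V : set T) : (forall e : R, (0 < e)%R ->
    exists gamma : probability T R,
      dW1 rho m gamma < e%:E /\ dW1 rho gamma n < e%:E) ->
    rho_open rho V -> m V <= n V.
  move=> {}H oV.
  pose F k := shrink rho (shrink rho V k.+1%:R^-1) k.+1%:R^-1.
  have VE : V = \bigcup_k F k by exact: rho_open_bigcup_shrink.
  have mV : measurable V by exact: (rho_open_measurable hborel).
  have := @nondecreasing_cvg_mu _ _ _ m F.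
  rewrite -VE => cF; apply: cvge_le (cF _ mV _); last 2 first.
  - by move=> k; exact: (measurable_shrink hmetric hborel).
  - move=> k l kl; apply/subsetPset => x Fx y xy z yz.
    have kl' : (l.+1%:R^-1 <= k.+1%:R^-1 :> R)%R.
      by rewrite lef_pV2 ?posrE// ler_nat.
    by apply: (Fx y) => //; [apply: lt_le_trans xy _|apply: lt_le_trans yz _].
  apply: nearW => k /=; apply/lee_addgt0Pr => e e0.
  pose c : R := k.+1%:R^-1%R; have c0 : (0 < c)%R by rewrite invr_gt0.
  (* Each of the two passages then has Markov error [(e * c / 2) / c = e / 2]. *)
  have [|g [mg gn]] := H (e * c / 2)%R; first by rewrite divr_gt0// mulr_gt0.
  have mS := measurable_shrink hmetric hborel V c.
  apply: le_trans (dW1_shrink mg c0 mS) _.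
  apply: (@le_trans _ _ ((n V + (e * c / 2 / c)%:E) + (e * c / 2 / c)%:E)).
    by rewrite leeD2r//; exact: dW1_shrink.
  rewrite -addeA leeD2l// -EFinD lee_fin.
  by rewrite [(e * c / 2)%R]mulrAC mulfK ?gt_eqF//; lra.
apply: (@measure_unique _ _ _ (rho_open rho) (fun _ => setT)) => //.
- move=> A B oA oB x [Ax Bx].
  have [e e0 eA] := oA x Ax; have [e' e'0 eB] := oB x Bx.
  exists (Num.min e e'); first by rewrite lt_min e0.
  by move=> y /=; rewrite lt_min => /andP[/eA Ay /eB By].
- by move=> _ x _; exists 1%R.
- by apply/seteqP; split=> // x _; exists 0%N.
- move=> A oA; apply/eqP; rewrite eq_le; apply/andP; split; first exact: le_open.
  apply: le_open => // e /H[g [mg gn]]; exists g.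
  by rewrite dW1_sym gn dW1_sym.
- by move=> _; rewrite /= probability_setT ltry.
Qed.

Lemma dW1_eq0 mu nu : dW1 rho mu nu = 0 -> meas_eq mu nu.
Proof.
move=> h; apply: meas_eq_of_dW1_approx => e e0.
by exists mu; rewrite dW1xx h lte_fin.
Qed.

End Wasserstein.

(** * Mixtures and conditioning *)

Section Mixtures.
Context {R : realType} {d : measure_display} {U : measurableType d}.
Local Open Scope ereal_scope.
Implicit Types P Q M : probability U R.

Definition is_mixture (t : R) P Q M : Prop :=
  forall A, measurable A -> M A = t%:E * P A + (1 - t)%:E * Q A.

Lemma mixture_exists t P Q : (0 <= t <= 1)%R -> exists M, is_mixture t P Q M.
Proof. by move=> /probability_mixture-/(_ _ _ P Q)[M [ME _]]; exists M => A _. Qed.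

Lemma mixture_integral t P Q M (f : U -> \bar R) : (0 <= t <= 1)%R ->
  is_mixture t P Q M -> measurable_fun setT f -> (forall x, 0 <= f x) ->
  \int[M]_x f x = t%:E * \int[P]_x f x + (1 - t)%:E * \int[Q]_x f x.
Proof.
move=> t01 ME mf f0; have [N [NE NI]] := probability_mixture P Q t01.
rewrite -NI//; apply: eq_measure_integral => A mA _.
by apply: etrans (ME A mA) _; apply: etrans _ (esym (NE A)).
Qed.

(** [P1] and [P2] are [P] conditioned on [A] and on its complement, both of positive mass. *)
Lemma probability_split P (A : set U) : measurable A -> P A != 0 -> P A != 1 ->
  exists t P1 P2, [/\ (0 < t < 1)%R, P A = t%:E, P1 (~` A) = 0, P2 A = 0 &
    is_mixture t P1 P2 P].
Proof.
move=> mA PA0 PA1; pose t := fine (P A).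
have tE : P A = t%:E by rewrite fineK// fin_num_measure.
have t0 : (0 < t)%R by rewrite -lte_fin -tE lt_neqAle eq_sym PA0/= measure_ge0.
have t1 : (t < 1)%R by rewrite -lte_fin -tE lt_neqAle PA1 probability_le1.
have s0 : (0 < 1 - t)%R by rewrite subr_gt0.
have mAC := measurableC mA.
have PAC : P (~` A) = (1 - t)%:E by rewrite probability_setC// tE.
have ti0 : (0 <= t^-1)%R by rewrite invr_ge0 ltW.
have si0 : (0 <= (1 - t)^-1)%R by rewrite invr_ge0 ltW.
pose m1 := mscale (NngNum ti0) (mrestr P mA).
pose m2 := mscale (NngNum si0) (mrestr P mAC).
have m1E B : m1 B = t^-1%:E * P (B `&` A) by [].
have m2E B : m2 B = (1 - t)^-1%:E * P (B `&` ~` A) by [].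
have [|P1 P1E] := @probability_of_measure R _ _ m1.
  apply: etrans (m1E _) _; rewrite setTI tE -EFinM mulVf// gt_eqF//.
have [|P2 P2E] := @probability_of_measure R _ _ m2.
  apply: etrans (m2E _) _; rewrite setTI PAC -EFinM mulVf// gt_eqF//.
exists t, P1, P2; split=> //; first by rewrite t0.
- apply: etrans (P1E _) _; apply: etrans (m1E _) _.
  by rewrite setICl measure0 mule0.
- apply: etrans (P2E _) _; apply: etrans (m2E _) _.
  by rewrite setICr measure0 mule0.
move=> B mB.
have -> : P1 B = t^-1%:E * P (B `&` A) by exact: etrans (P1E _) (m1E _).
have -> : P2 B = (1 - t)^-1%:E * P (B `&` ~` A) by exact: etrans (P2E _) (m2E _).
rewrite !muleA -!EFinM !divff ?gt_eqF// !mul1e.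
rewrite -measureU//; [|exact: measurableI..|].
  by rewrite -setIUr setUv setIT.
by rewrite setIACA setICr setI0.
Qed.

End Mixtures.

(* The hypothesis is an inequality because the reverse one, the triangle
   inequality for [dW1], is not available. *)
Definition metrically_extreme {R : realType} {d : measure_display}
    {T : measurableType d} (rho : T -> T -> R) (mu : probability T R) : Prop :=
  forall mu1 mu2, W1 rho mu1 -> W1 rho mu2 ->
    (dW1 rho mu1 mu + dW1 rho mu mu2 <= dW1 rho mu1 mu2)%E ->
    meas_eq mu1 mu \/ meas_eq mu2 mu.

(** * Metric characterisation of Dirac measures *)

Section DiracExtremal.
Context {R : realType} {d : measure_display} {T : measurableType d}.
Context {rho : T -> T -> R}.
Context (hmetric : is_metric rho) (hsep : metric_separable rho).
Context (hborel : @measurable d T = <<s rho_open rho >>).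
Implicit Types mu nu : probability T R.

Let rho0 := rho_ge0 hmetric.
Let rhoC := rho_sym hmetric.
Let mrho : measurable_fun setT (fun z : T * T => rho z.1 z.2) :=
  measurable_metric hmetric hsep hborel.
Let mrhol x : measurable_fun setT (fun z : T => rho z x) :=
  measurable_metric_l hmetric hsep hborel x.
Let mset1 (x : T) : measurable [set x] :=
  metric_measurable_set1 hmetric hborel x.
Local Open Scope ereal_scope.

Let erho0 x y : 0 <= (rho x y)%:E. Proof. by rewrite lee_fin. Qed.
Let emrho : measurable_fun setT (fun z : T * T => (rho z.1 z.2)%:E).
Proof. exact/measurable_EFinP. Qed.
Let emrhol x : measurable_fun setT (fun z : T => (rho z x)%:E).
Proof. exact/measurable_EFinP. Qed.
Let mrho1 x : measurable_fun setT (fun z : T * T => rho z.1 x).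
Proof. exact: (measurableT_comp (mrhol x) measurable_fst). Qed.
Let mrho2 x : measurable_fun setT (fun z : T * T => rho z.2 x).
Proof. exact: (measurableT_comp (mrhol x) measurable_snd). Qed.

(** A mixture of couplings couples the mixtures, and costs mix with the same weights. *)
Lemma mixture_coupling t mu1 mu2 mu nu1 nu2 nu pi1 pi2 : (0 <= t <= 1)%R ->
  is_mixture t mu1 mu2 mu -> is_mixture t nu1 nu2 nu ->
  couplings mu1 nu1 pi1 -> couplings mu2 nu2 pi2 ->
  dW1 rho mu nu <= t%:E * \int[pi1]_z (rho z.1 z.2)%:E +
                   (1 - t)%:E * \int[pi2]_z (rho z.1 z.2)%:E.
Proof.
move=> t01 muE nuE c1 c2; have [pi [piE piI]] := probability_mixture pi1 pi2 t01.
rewrite -piI//; apply: dW1_le_cost => A mA; rewrite !piE muE// nuE//.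
by rewrite (c1 A mA).1 (c2 A mA).1 (c1 A mA).2 (c2 A mA).2.
Qed.

Lemma mixturexx t mu : is_mixture t mu mu mu.
Proof.
move=> A mA; rewrite -[in RHS](@fineK _ (mu A)) ?fin_num_measure//.
by rewrite -!EFinM -EFinD -mulrDl addrC subrK mul1r fineK// fin_num_measure.
Qed.

(** Let [pi] couple [mu1] and [mu2] at cost [c]. From [mu1] to [mu] the share [t] stays and the rest
    follows [pi], at cost [(1 - t) c]; from [mu] to [mu2] the share [t] follows [pi], at cost
    [t c]. *)
Lemma dW1_mixture t mu1 mu2 mu : (0 <= t <= 1)%R -> is_mixture t mu1 mu2 mu ->
  dW1 rho mu1 mu + dW1 rho mu mu2 <= dW1 rho mu1 mu2.
Proof.
move=> t01 muE; apply: dW1_lower_bound => pi cpi.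
have [p1 cp1 p10] := coupling_diag hmetric hsep hborel mu1.
have [p2 cp2 p20] := coupling_diag hmetric hsep hborel mu2.
have h1 := mixture_coupling t01 (mixturexx t mu1) muE cp1 cpi.
have h2 := mixture_coupling t01 muE (mixturexx t mu2) cpi cp2.
apply: le_trans (leeD h1 h2) _; rewrite p10 p20 !mule0 adde0 add0e.
have /andP[t0 t1] := t01.
rewrite -ge0_muleDl ?lee_fin ?subr_ge0//.
by rewrite -EFinD subrK mul1e.
Qed.

Lemma meas_eq_dirac mu x : mu (~` [set x]) = 0 -> meas_eq mu (dirac x).
Proof.
move=> h A mA; rewrite pdiracE.
have null B : measurable B -> ~ B x -> mu B = 0.
  move=> mB Bx; apply/eqP; rewrite eq_le measure_ge0 andbT -h.
  apply: le_measure; rewrite ?inE//; first exact: measurableC.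
  by move=> y By /= yx; apply: Bx; rewrite -yx.
case: (pselect (A x)) => Ax; last by rewrite memNset// null.
rewrite mem_set// -(setCK A) probability_setC; last exact: measurableC.
by rewrite null ?sube0//; exact: measurableC.
Qed.

(** At each scale some ball about a term of the dense sequence has mass 1, for otherwise countably
    many null balls would cover the space. The intersection [C] of these balls has mass 1 and, the
    radii tending to 0, is a single point. *)
Lemma dirac_of_zero_one mu :
  (forall A, measurable A -> mu A = 0 \/ mu A = 1) ->
  exists x, meas_eq mu (dirac x).
Proof.
move=> h01; have [s sdense] := metric_dense_seq hsep.
pose B n k := [set y | rho y (s k) < n.+1%:R^-1]%R.
have mB n k : measurable (B n k).
  exact/(rho_open_measurable hborel)/(rho_open_ball hmetric).
have full n : exists k, mu (B n k) = 1.
  apply: contrapT => /forallNP nB.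
  have : mu setT = 0.
    have -> : [set: T] = \bigcup_k B n k.
      apply/seteqP; split=> // x _.
      have [|k xk] := sdense x n.+1%:R^-1%R; first by rewrite invr_gt0.
      by exists k.
    apply: measure_negligible; first exact: bigcupT_measurable.
    apply: negligible_bigcup => k; apply/negligibleP => //.
    by have [//|/nB] := h01 _ (mB n k).
  by rewrite probability_setT => /eqP; rewrite onee_eq0.
have [k kP] := choice full.
pose C := \bigcap_n B n (k n).
have mC : measurable C by exact: bigcapT_measurable.
have C0 : mu (~` C) = 0.
  rewrite setC_bigcap; apply: measure_negligible.
    by apply: bigcupT_measurable => n; exact: measurableC.
  apply: negligible_bigcup => n; apply/negligibleP; first exact: measurableC.
  by rewrite /= probability_setC// kP subee.
have [x Cx] : C !=set0.
  apply/set0P/eqP => Ce; move: C0; rewrite Ce setC0 probability_setT => /eqP.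
  by rewrite onee_eq0.
exists x; apply: meas_eq_dirac; apply/eqP; rewrite eq_le measure_ge0 andbT -C0.
apply: le_measure; rewrite ?inE; [exact: measurableC..|].
move=> y /= yx Cy; have := rho_gt0 hmetric yx => e0.
have [|n ne] := @exists_inv_lt R (rho y x / 2); first lra.
have := rho_triangle hmetric (s (k n)) y x; rewrite (rhoC (s (k n)) x).
have := Cx n I; have := Cy n I; rewrite /B /=.
by move: ne; move: n.+1%:R^-1%R => i; lra.
Qed.

(** If [mu A] were neither 0 nor 1, [mu] would lie between its conditionings on [A] and on the
    complement. Both differ from [mu], since one vanishes off [A] and the other on [A]. *)
Lemma extreme_is_dirac mu : W1 rho mu -> metrically_extreme rho mu ->
  exists x, meas_eq mu (dirac x).
Proof.
move=> Wmu ext; apply: dirac_of_zero_one => A mA.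
have [|A0] := eqVneq (mu A) 0; first by left.
have [|A1] := eqVneq (mu A) 1; first by right.
have [t [mu1 [mu2 [t01 muA mu1A mu2A mix]]]] := probability_split mA A0 A1.
have /andP[t0 t1] := t01.
have t01' : (0 <= t <= 1)%R by rewrite !ltW.
have [x xoo] := Wmu.
have I0 nu : 0 <= \int[nu]_z (rho z x)%:E by exact: integral_ge0.
move: xoo; rewrite (mixture_integral t01' mix)// => xoo.
have [] := ext mu1 mu2.
(* A component of positive weight and infinite first moment would make the first moment of [mu]
   infinite. *)
- exists x; move: xoo; have [//|] := ltP (\int[mu1]_z (rho z x)%:E) +oo.
  rewrite leye_eq => /eqP ->; rewrite gt0_muley ?lte_fin// addye//.
  by rewrite gt_eqF// (lt_le_trans ltNy0)// mule_ge0// lee_fin; lra.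
- exists x; move: xoo; have [//|] := ltP (\int[mu2]_z (rho z x)%:E) +oo.
  rewrite leye_eq => /eqP ->; rewrite gt0_muley ?lte_fin ?subr_gt0// addey//.
  by rewrite gt_eqF// (lt_le_trans ltNy0)// mule_ge0// lee_fin; lra.
- exact: dW1_mixture mix.
- move=> /(_ _ (measurableC mA)); rewrite mu1A probability_setC// muA.
  move=> /eqP; rewrite eq_sym -EFinB eqe subr_eq0 => /eqP t1'.
  by rewrite t1' ltxx in t1.
- by move=> /(_ _ mA); rewrite mu2A => /esym/eqP; rewrite (negbTE A0).
Qed.

(** The mean detour through [x] is at most the distance from [mu1] to [mu2], hence at most the cost
    of the product coupling, so the detour is strictly longer only on a null set. That set is the
    square of the complement of [x], so one of the two measures is carried by [x]. *)
Lemma dirac_extreme (hstrict : strict_triangle rho) x :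
  metrically_extreme rho (dirac x).
Proof.
move=> mu1 mu2 W1mu W2mu; rewrite dW1_dirac// dW1_dirac_l// => h.
have [M ME] := probability_product mu1 mu2.
have cM : couplings mu1 mu2 M.
  by move=> A mA; rewrite !ME// !probability_setT mule1 mul1e.
pose f (z : T * T) := rho z.1 z.2.
pose g (z : T * T) := (rho z.1 x + rho z.2 x)%R.
have mg : measurable_fun setT g by exact: measurable_funD.
have fg z : (f z <= g z)%R.
  by rewrite /g (rhoC z.2); exact: (rho_triangle hmetric).
have gE : \int[M]_z (g z)%:E =
    \int[mu1]_z (rho z x)%:E + \int[mu2]_z (rho z x)%:E.
  rewrite -(coupling_integral_fst cM)// -(coupling_integral_snd cM)//.
  by rewrite -ge0_integralD//; exact/measurable_EFinP.
have goo : \int[M]_z (g z)%:E < +oo.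
  by rewrite gE lte_add_pinfty// W1_integral_lty.
have SE : [set z | f z < g z]%R = (~` [set x]) `*` (~` [set x]).
  apply/seteqP; split=> -[a b]; rewrite /f /g /=.
    move=> ab; split=> e; move: ab; rewrite e (rho_xx hmetric).
      by rewrite add0r rhoC ltxx.
    by rewrite addr0 ltxx.
  by move=> [ax bx]; rewrite (rhoC b); apply: hstrict; exact/nesym.
have /eqP : mu1 (~` [set x]) * mu2 (~` [set x]) = 0.
  rewrite -ME; [|exact: measurableC..]; rewrite -SE.
  apply: measure_gap_eq0 => //; first by move=> z; exact: rho0.
  - apply: le_lt_trans goo; apply: ge0_le_integral => //.
    + by move=> z _; exact: erho0.
    + exact/measurable_EFinP.
    + by move=> z _; rewrite lee_fin.
  - by rewrite gE; apply: le_trans h (dW1_le_cost cM).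
by rewrite mule_eq0 => /orP[]/eqP/meas_eq_dirac; [left|right].
Qed.

End DiracExtremal.

(** * Measures carried by a countable set *)

Section AtomicMeasures.
Context {R : realType} {d : measure_display} {U : measurableType d}.
Local Open Scope ereal_scope.

Lemma atomic_measure_le (P Q : {measure set U -> \bar R}) (s : nat -> U) :
  (forall k, measurable [set s k]) -> P (~` range s) = 0 ->
  (forall k, P [set s k] <= Q [set s k]) ->
  forall A, measurable A -> P A <= Q A.
Proof.
move=> ms P0 PQ A mA; pose F k := A `&` [set s k].
have mF k : measurable (F k) by exact: measurableI.
(* [s] may repeat points; [seqDU] keeps only first occurrences, so each piece is empty or a
   singleton. *)
have mD := seqDU_measurable mF.
have mr : measurable (range s).
  have -> : range s = \bigcup_k [set s k].
    by apply/seteqP; split=> [_ [k _ <-]|x [k _ ->]]; exists k.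
  exact: bigcupT_measurable.
have AE : A `&` range s = \bigcup_k seqDU F k.
  rewrite -seqDU_bigcup_eq; apply/seteqP.
  split=> [x [Ax [k _ xk]]|x [k _ [Ax xk]]].
    by exists k.
  by split=> //; exists k.
have tD := @trivIset_seqDU _ F.
have mU : measurable (\bigcup_k seqDU F k) by exact: bigcupT_measurable.
have PA : P A = P (\bigcup_k seqDU F k).
  rewrite -AE [LHS](measureDI _ mA mr) [X in X + _ = _](_ : _ = 0) ?add0e//.
  apply/eqP; rewrite eq_le measure_ge0 andbT -P0.
  apply: le_measure; rewrite ?inE; [exact: measurableD|exact: measurableC|].
  by move=> x [].
apply: (@le_trans _ _ (Q (\bigcup_k seqDU F k))); last first.
  by apply: le_measure; rewrite ?inE// -AE => x [].
rewrite PA !measure_semi_bigcup//; apply: lee_nneseries => // k _.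
have [->|/set0P[x Dx]] := eqVneq (seqDU F k) set0.
  by rewrite !measure0.
suff -> : seqDU F k = [set s k] by [].
have [[Ax xk] _] := Dx.
apply/seteqP; split=> [y [[_ ->] _]//|y ->].
by rewrite -xk.
Qed.

(** The inequality on the complement is the reverse inequality on [A], both total masses being 1. *)
Lemma probability_le_eq (P Q : probability U R) :
  (forall A, measurable A -> P A <= Q A) -> meas_eq P Q.
Proof.
move=> PQ A mA; apply/eqP; rewrite eq_le PQ//=.
have := PQ _ (measurableC mA); rewrite !probability_setC//.
rewrite -(@fineK _ (P A)) ?fin_num_measure// -(@fineK _ (Q A)) ?fin_num_measure//.
by rewrite -!EFinB !lee_fin; lra.
Qed.

End AtomicMeasures.

(** * Two-point measures and masses of atoms *)

Section Atoms.
Context {R : realType} {d : measure_display} {T : measurableType d}.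
Context {rho : T -> T -> R}.
Context (hmetric : is_metric rho) (hsep : metric_separable rho).
Context (hborel : @measurable d T = <<s rho_open rho >>).
Implicit Types mu nu eta : probability T R.

Let rho0 := rho_ge0 hmetric.
Let rhoC := rho_sym hmetric.
Let mrho : measurable_fun setT (fun z : T * T => rho z.1 z.2) :=
  measurable_metric hmetric hsep hborel.
Let mrhol x : measurable_fun setT (fun z : T => rho z x) :=
  measurable_metric_l hmetric hsep hborel x.
Let mset1 (x : T) : measurable [set x] :=
  metric_measurable_set1 hmetric hborel x.
Local Open Scope ereal_scope.

Let erho0 x y : 0 <= (rho x y)%:E. Proof. by rewrite lee_fin. Qed.
Let emrho : measurable_fun setT (fun z : T * T => (rho z.1 z.2)%:E).
Proof. exact/measurable_EFinP. Qed.
Let emrhol x : measurable_fun setT (fun z : T => (rho z x)%:E).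
Proof. exact/measurable_EFinP. Qed.
Let mrho1 x : measurable_fun setT (fun z : T * T => rho z.1 x).
Proof. exact: (measurableT_comp (mrhol x) measurable_fst). Qed.
Let mrho2 x : measurable_fun setT (fun z : T * T => rho z.2 x).
Proof. exact: (measurableT_comp (mrhol x) measurable_snd). Qed.

(** Leaving the atom at [y] in place and moving all other mass to [x] costs the part of the integral
    over [mu] that does not come from [y]; the part from [y] is the integral over [nu]. *)
Lemma dW1_two_point_atom mu nu x y (t : R) :
  (0 < t < 1)%R -> mu [set y] = t%:E ->
  is_mixture t (dirac y) (dirac x) nu ->
  dW1 rho mu nu + \int[nu]_z (rho z x)%:E <= \int[mu]_z (rho z x)%:E.
Proof.
move=> t01 muy nuE; have /andP[t0 t1] := t01.
have t01' : (0 <= t <= 1)%R by rewrite !ltW.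
have := @probability_split R _ _ mu _ (mset1 y); rewrite muy.
rewrite !eqe gt_eqF// lt_eqF// => -[]//.
move=> t' [mu1 [mu2 [_ [<-] /meas_eq_dirac mu1E _ mix]]].
have {}mu1E := mu1E _ hmetric hborel.
have {}mix : is_mixture t (dirac y) mu2 mu by move=> A mA; rewrite mix// mu1E.
have [p1 cp1 p1E] := coupling_diag hmetric hsep hborel (dirac y).
have [p2 cp2 p2E] := coupling_dirac hmetric hsep hborel mu2 x.
have := mixture_coupling hmetric hsep hborel t01' mix nuE cp1 cp2.
rewrite p1E p2E mule0 add0e => h.
rewrite (mixture_integral t01' mix)// (mixture_integral t01' nuE)//.
rewrite !(integral_rho_dirac hmetric hsep hborel) (rho_xx hmetric) mule0 adde0.
by rewrite addeC leeD2l.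
Qed.

(** The two integrals add up to [rho y x], a pointwise lower bound of [rho z x + rho z y]. Equality
    thus holds almost everywhere, which leaves only the points [x] and [y], and the first integral
    is [rho y x] times the mass at [y]. *)
Lemma two_point_mass (hstrict : strict_triangle rho) eta x y (t : R) :
  x <> y ->
  \int[eta]_z (rho z x)%:E = (t * rho y x)%:E ->
  \int[eta]_z (rho z y)%:E = ((1 - t) * rho y x)%:E ->
  eta [set y] = t%:E.
Proof.
move=> xy ex ey.
have ryx : (0 < rho y x)%R by apply: (rho_gt0 hmetric); exact: nesym.
have N0 : eta [set z | rho y x < rho z x + rho z y]%R = 0.
  apply: (@measure_gap_eq0 R _ _ eta (fun=> rho y x)) => //.
  - exact: measurable_funD.
  - by move=> z /=; rewrite addrC (rhoC z y); exact: (rho_triangle hmetric).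
  - by rewrite integral_cst//= probability_setT mule1 ltry.
  - under eq_integral do rewrite EFinD.
    rewrite ge0_integralD// ex ey integral_cst//= probability_setT mule1.
    by rewrite -EFinD lee_fin -mulrDl addrC subrK mul1r.
have : \int[eta]_z (rho z x)%:E =
    \int[eta]_z ((rho y x)%:E * (\1_[set y] z)%:E).
  apply: ge0_ae_eq_integral => //.
  - by apply: measurable_funeM; exact/measurable_EFinP/measurable_indic.
  - by move=> z _; rewrite mule_ge0// lee_fin.
  - exists [set z | rho y x < rho z x + rho z y]%R; split=> //.
      rewrite (_ : [set _ | _] =
          ~` [set z | rho z x + rho z y <= rho y x]%R).
        apply: measurableC; apply: measurable_set_ler => //.
        exact: measurable_funD.
      by apply/seteqP; split=> z /=; rewrite ltNge => /negP.
    move=> z /= /not_implyP[_] h.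
    have zy : y <> z.
      by move=> e; apply: h; rewrite -e indicE mem_set//= mule1.
    rewrite addrC (rhoC z y); apply: hstrict; first exact: nesym.
    move=> zx; apply: h; rewrite zx (rho_xx hmetric) indicE memNset/= ?mule0//.
rewrite ge0_integralZl//; last exact/measurable_EFinP/measurable_indic.
rewrite integral_indic// setIT ex => h.
have : (t * rho y x)%:E * (rho y x)^-1%:E =
    (rho y x)^-1%:E * ((rho y x)%:E * eta [set y]).
  by rewrite h muleC.
by rewrite muleA -!EFinM mulfK ?gt_eqF// mulVf ?gt_eqF// mul1e.
Qed.

(* Transport to [nu] followed by transport to [x] is no more expensive than
   direct transport to [x], so under an almost optimal coupling almost all of
   the mass arriving at [y] starts at points [z] with almost no detour
   [rho z y + rho y x - rho z x], that is, near [y] in the sense of [F n]. *)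
Lemma atom_le (hstrict : strict_triangle rho) eta nu x y :
  x <> y -> W1 rho eta ->
  dW1 rho eta nu + \int[nu]_z (rho z x)%:E <= \int[eta]_z (rho z x)%:E ->
  nu [set y] <= eta [set y].
Proof.
move=> xy Weta h.
pose F n := [set z | rho z y + rho y x - rho z x <= n.+1%:R^-1]%R.
have mF n : measurable (F n).
  apply: measurable_set_ler => //.
  by apply: measurable_funB => //; exact: measurable_funD.
have FE : [set y] = \bigcap_n F n.
  apply/seteqP; split=> [z -> n _|z Fz].
    by rewrite /F /= (rho_xx hmetric) add0r subrr.
  apply: contrapT => /= zy.
  have := hstrict z x y (nesym zy) (nesym xy) => k.
  have [|n ne] := @exists_inv_lt R (rho z y + rho y x - rho z x).
    by rewrite subr_gt0.
  by have := lt_le_trans ne (Fz n I); rewrite ltxx.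
have := @nonincreasing_cvg_mu _ _ _ eta F.
rewrite -FE => cF.
have {}cF : (eta \o F) n @[n --> \oo] --> eta [set y].
  apply: cF => //.
  - by rewrite (le_lt_trans (probability_le1 _ _)) ?ltry.
  - move=> n m nm; apply/subsetPset => z Fz; apply: le_trans Fz _.
    by rewrite lef_pV2 ?posrE// ler_nat.
apply: cvge_ge cF; apply: nearW => n /=.
apply/lee_addgt0Pr => e e0.
pose c : R := n.+1%:R^-1%R; have c0 : (0 < c)%R by rewrite invr_gt0.
have dfin : dW1 rho eta nu \is a fin_num.
  rewrite ge0_fin_numE; last exact: dW1_ge0.
  apply: le_lt_trans (_ : \int[eta]_z (rho z x)%:E < +oo); last first.
    exact: W1_integral_lty.
  by apply: le_trans h; rewrite leeDl//; exact: integral_ge0.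
(* With the slack [e * c], Markov's inequality at the threshold [c] gives [pi G <= e]. *)
have : dW1 rho eta nu < dW1 rho eta nu + (e * c)%:E.
  by rewrite lteDl// lte_fin mulr_gt0.
move=> /ereal_inf_lt[_ [pi cpi <-] pie].
pose G := [set z : T * T | c <= (rho z.1 z.2 + rho z.2 x) - rho z.1 x]%R.
have piG : c%:E * pi G <= (e * c)%:E.
  apply: measure_gap_ge => //.
  - exact: measurable_funD.
  - by move=> z; exact: (rho_triangle hmetric).
  - rewrite (coupling_integral_fst (f := fun z => (rho z x)%:E) cpi)//.
    exact: W1_integral_lty.
  - under eq_integral do rewrite EFinD.
    rewrite ge0_integralD//; last exact/measurable_EFinP.
    rewrite (coupling_integral_fst (f := fun z => (rho z x)%:E) cpi)//.
    rewrite (coupling_integral_snd (f := fun z => (rho z x)%:E) cpi)//.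
    apply: le_trans (leeD2r _ (ltW pie)) _.
    by rewrite addeAC leeD2r.
have mG : measurable G.
  apply: measurable_set_ler => //.
  by apply: measurable_funB => //; exact: measurable_funD.
have {}piG : pi G <= e%:E by move: piG; rewrite mulrC EFinM lee_pmul2l.
rewrite -(cpi _ (mset1 y)).2 -(cpi _ (mF n)).1.
apply: (@le_trans _ _ (pi ((F n `*` setT) `|` G))).
  apply: le_measure; rewrite ?inE//.
  - exact: measurableX.
  - by apply: measurableU => //; exact: measurableX.
  - move=> [a b] /= [_ ->].
    have [ac|ac] := leP (rho a y + rho y x - rho a x)%R c; first by left.
    by right; exact: ltW.
apply: le_trans (measureU2 _ _ _) _ => //; first exact: measurableX.
by rewrite leeD2l.
Qed.

(** Each point goes to the first term of the dense sequence closer than [e]; the level sets of this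
    index are differences of open sets. *)
Lemma countable_range_approx (e : R) : (0 < e)%R ->
  exists (f : T -> T) (s : nat -> T), [/\ measurable_fun setT f,
    forall x, (rho x (f x) < e)%R & forall x, exists k, f x = s k].
Proof.
move=> e0; have [s sdense] := metric_dense_seq hsep.
have ex x : exists k, (rho x (s k) < e)%R by exact: sdense.
pose idx x := ex_minn (ex x).
exists (s \o idx), s; split.
- pose B k := [set x | rho x (s k) < e]%R.
  move=> _ A mA; rewrite setTI.
  have -> : (s \o idx) @^-1` A = \bigcup_(k in [set k | A (s k)])
      seqDU B k.
    apply/seteqP; split=> [x /= Ax|x [k /= Ak [xk nk]]].
      exists (idx x) => //; rewrite /seqDU /idx; case: ex_minnP => k xk min.
      split=> //; rewrite -bigcup_mkord => -[j /= jk xj].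
      by have := min _ xj; rewrite leqNgt jk.
    suff -> : idx x = k by [].
    rewrite /idx; case: ex_minnP => j xj min.
    apply/eqP; rewrite eqn_leq min//= leqNgt; apply/negP => jk.
    by apply: nk; rewrite -bigcup_mkord; exists j.
  apply: bigcup_measurable => k _; apply: seqDU_measurable => j.
  exact/(rho_open_measurable hborel)/(rho_open_ball hmetric).
- by move=> x; rewrite /= /idx; case: ex_minnP.
- by move=> x; exists (idx x).
Qed.

End Atoms.

(** * Action of the isometry on Dirac measures *)

Section Rigidity.
Context {R : realType} {d : measure_display} {T : measurableType d}.
Context {rho : T -> T -> R}.
Context (hmetric : is_metric rho) (hsep : metric_separable rho).
Context (hborel : @measurable d T = <<s rho_open rho >>).
Context (hstrict : strict_triangle rho).
Context (Phi : probability T R -> probability T R).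
Context (hmaps : forall mu, W1 rho mu -> W1 rho (Phi mu)).
Context (hinj : forall mu nu, W1 rho mu -> W1 rho nu ->
  meas_eq (Phi mu) (Phi nu) -> meas_eq mu nu).
Context (hsurj : forall nu, W1 rho nu ->
  exists2 mu, W1 rho mu & meas_eq (Phi mu) nu).
Context (hiso : forall mu nu, W1 rho mu -> W1 rho nu ->
  dW1 rho (Phi mu) (Phi nu) = dW1 rho mu nu).
Implicit Types mu nu eta : probability T R.
Local Open Scope ereal_scope.

Let rhoC := rho_sym hmetric.
Let erho0 x y : 0 <= (rho x y)%:E. Proof. by rewrite lee_fin (rho_ge0 hmetric). Qed.
Let emrhol x : measurable_fun setT (fun z : T => (rho z x)%:E).
Proof. exact/measurable_EFinP/(measurable_metric_l hmetric hsep hborel). Qed.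
Let mset1 (x : T) : measurable [set x] :=
  metric_measurable_set1 hmetric hborel x.
Let Wdirac x : W1 rho (dirac x) := W1_dirac hmetric hsep hborel x.

Lemma meas_eq_sym mu nu : meas_eq mu nu -> meas_eq nu mu.
Proof. by move=> h A mA; rewrite h. Qed.

Lemma meas_eq_trans mu nu eta : meas_eq mu nu -> meas_eq nu eta -> meas_eq mu eta.
Proof. by move=> h1 h2 A mA; rewrite h1// h2. Qed.

(** [meas_eq] is coarser than equality of [probability] objects, so its preservation by [Phi] has to
    be derived: distance 0 is preserved, and distance 0 separates measures. *)
Lemma isometry_meas_eq mu nu : W1 rho mu -> W1 rho nu -> meas_eq mu nu ->
  meas_eq (Phi mu) (Phi nu).
Proof.
move=> Wmu Wnu h; apply: (dW1_eq0 hmetric hsep hborel); rewrite hiso//.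
by rewrite (eq_dW1 h (fun A _ => erefl (nu A))) dW1xx.
Qed.

(** Extremality is expressed by distances alone; surjectivity pulls the two outer measures back. The
    converse that follows pushes them forward and uses injectivity. *)
Lemma isometry_extreme mu : W1 rho mu -> metrically_extreme rho mu ->
  metrically_extreme rho (Phi mu).
Proof.
move=> Wmu ext m1 m2 W1m W2m h.
have [n1 W1n e1] := hsurj W1m; have [n2 W2n e2] := hsurj W2m.
have rfl : meas_eq (Phi mu) (Phi mu) by [].
move: h; rewrite -(eq_dW1 e1 rfl) -(eq_dW1 rfl e2) -(eq_dW1 e1 e2).
rewrite !hiso//.
move=> /(ext _ _ W1n W2n)[h|h]; [left|right];
  [apply: meas_eq_trans (meas_eq_sym e1) _
  |apply: meas_eq_trans (meas_eq_sym e2) _]; exact: isometry_meas_eq.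
Qed.

Lemma isometry_extreme_inv mu : W1 rho mu ->
  metrically_extreme rho (Phi mu) -> metrically_extreme rho mu.
Proof.
move=> Wmu ext m1 m2 W1m W2m.
rewrite -(hiso W1m Wmu) -(hiso Wmu W2m) -(hiso W1m W2m).
by move=> /(ext _ _ (hmaps W1m) (hmaps W2m))[h|h]; [left|right]; exact: hinj.
Qed.

Lemma extreme_meas_eq mu nu : meas_eq mu nu -> metrically_extreme rho mu ->
  metrically_extreme rho nu.
Proof.
move=> h ext m1 m2 W1m W2m.
have r m : meas_eq (m : probability T R) m by [].
rewrite -(eq_dW1 (r m1) h) -(eq_dW1 h (r m2)) => /(ext _ _ W1m W2m)[k|k];
  [left|right]; exact: meas_eq_trans k h.
Qed.

Lemma meas_eq_dirac_inj (x y : T) :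
  meas_eq (dirac x : probability T R) (dirac y : probability T R) -> x = y.
Proof.
move=> /(_ _ (mset1 y)); rewrite !pdiracE [y \in _]mem_set//.
case: (pselect ([set y] x)) => // xy; rewrite memNset//= => /eqP.
by rewrite eqe eq_sym oner_eq0.
Qed.

(** Preservation of extremality yields [psi] by choice, its reflection makes [psi] surjective, and
    distances between Dirac measures are distances between points. *)
Lemma isometry_on_diracs : exists psi : T -> T, metric_isometry rho psi /\
  forall x, meas_eq (Phi (dirac x)) (dirac (psi x)).
Proof.
have /choice[psi psiE] (x : T) : exists y, meas_eq (Phi (dirac x)) (dirac y).
  apply: (extreme_is_dirac hmetric hsep hborel); first exact: hmaps.
  apply: isometry_extreme; first exact: Wdirac.
  exact: dirac_extreme.
have psi_iso x y : rho (psi x) (psi y) = rho x y.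
  apply: EFin_inj; rewrite -!(dW1_dirac_dirac hmetric hsep hborel).
  by rewrite -(eq_dW1 (psiE x) (psiE y)) hiso.
have psi_inj : injective psi.
  move=> x y e; apply/(hmetric.2.1 x y); rewrite -psi_iso e.
  exact: rho_xx.
have /choice[g gK] (y : T) : exists x, psi x = y.
  have [mu Wmu muE] := hsurj (Wdirac y).
  have [|x xE] := @extreme_is_dirac _ _ _ _ hmetric hsep hborel _ Wmu.
    apply: isometry_extreme_inv => //.
    by apply: extreme_meas_eq (meas_eq_sym muE) _; exact: dirac_extreme.
  exists x; apply: meas_eq_dirac_inj.
  apply: meas_eq_trans (meas_eq_sym (psiE x)) _.
  apply: meas_eq_trans muE; apply: isometry_meas_eq => //.
  exact: meas_eq_sym.
exists psi; split=> //; split=> //.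
by exists g => // x; apply: psi_inj; rewrite gK.
Qed.

(** * From atoms to push-forwards along [psi] *)

Section Psi.
Context (psi : T -> T) (psiP : metric_isometry rho psi).
Context (psiE : forall x, meas_eq (Phi (dirac x)) (dirac (psi x))).

Lemma isometry_integral_rho mu x : W1 rho mu ->
  \int[Phi mu]_z (rho z (psi x))%:E = \int[mu]_z (rho z x)%:E.
Proof.
move=> Wmu; rewrite -!(dW1_dirac hmetric hsep hborel) -(hiso Wmu (Wdirac x)).
by apply: eq_dW1 => //; exact/meas_eq_sym/psiE.
Qed.

(** The two-point measure [nu] with mass [t = mu {y}] at [y] and the rest at [x] lies between [mu]
    and [dirac x]. [Phi] preserves this relation, [two_point_mass] locates the mass [t] of [Phi nu]
    at [psi y], and [atom_le] bounds it by that of [Phi mu]. The cases [t = 0] and [t = 1] are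
    treated apart. *)
Lemma isometry_atom_le mu y : W1 rho mu -> mu [set y] <= Phi mu [set psi y].
Proof.
move=> Wmu.
have [->|mu0] := eqVneq (mu [set y]) 0; first exact: measure_ge0.
have [mu1|mu1] := eqVneq (mu [set y]) 1.
  have h : meas_eq mu (dirac y).
    apply: (meas_eq_dirac hmetric hborel).
    by rewrite probability_setC// mu1 subee.
  rewrite (isometry_meas_eq Wmu (Wdirac y) h)// psiE// pdiracE mem_set//.
  exact: probability_le1.
have [x xy] : exists x, x <> y.
  apply: contrapT => /forallNP nx; move/eqP: mu1; apply.
  rewrite -(probability_setT mu); congr (mu _).
  by apply/seteqP; split=> // z _; apply: contrapT => /nx.
pose t := fine (mu [set y]).
have tE : mu [set y] = t%:E by rewrite fineK// fin_num_measure.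
have t0 : (0 < t)%R by rewrite -lte_fin -tE lt_neqAle eq_sym mu0/= measure_ge0.
have t1 : (t < 1)%R by rewrite -lte_fin -tE lt_neqAle mu1 probability_le1.
have t01 : (0 <= t <= 1)%R by rewrite !ltW.
have [nu nuE] := mixture_exists (dirac y : probability T R) (dirac x) t01.
have nuI w : \int[nu]_z (rho z w)%:E = (t * rho y w + (1 - t) * rho x w)%:E.
  by rewrite (mixture_integral t01 nuE)// !(integral_rho_dirac hmetric hsep hborel).
have Wnu : W1 rho nu by exists x; rewrite nuI ltry.
have psixy : psi x <> psi y by move=> /(bij_inj psiP.1).
have Phinu : Phi nu [set psi y] = t%:E.
  apply: (two_point_mass hmetric hsep hborel hstrict psixy).
    by rewrite isometry_integral_rho// nuI (rho_xx hmetric) mulr0 addr0 psiP.2.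
  by rewrite isometry_integral_rho// nuI (rho_xx hmetric) mulr0 add0r psiP.2 rhoC.
rewrite tE -Phinu.
apply: (atom_le hmetric hsep hborel hstrict psixy); first exact: hmaps.
rewrite hiso// !isometry_integral_rho//.
apply: (dW1_two_point_atom hmetric hsep hborel _ tE nuE).
by rewrite t0.
Qed.

Lemma measurable_isometry : measurable_fun setT psi.
Proof.
apply: (measurability _ hborel) => _ [A oA <-]; rewrite setTI.
apply: (rho_open_measurable hborel) => x /oA[e e0 eA].
by exists e => // y /= xy; apply: eA => /=; rewrite psiP.2.
Qed.

(** The push-forward is carried by the range of [psi \o s], and [Phi mu] dominates it atom by atom;
    domination between probabilities is equality. *)
Lemma isometry_pushforward_atomic mu (s : nat -> T) : W1 rho mu ->
  mu (~` range s) = 0 -> forall A, measurable A -> Phi mu A = mu (psi @^-1` A).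
Proof.
move=> Wmu mus A mA.
have [nu [nuE _]] := probability_pushforward mu measurable_isometry.
rewrite -nuE; apply/esym; move: A mA; apply: probability_le_eq.
apply: (@atomic_measure_le _ _ _ _ _ (psi \o s)) => //.
- apply: etrans (nuE _) _; rewrite -mus; congr (mu _).
  apply/seteqP; split=> x /= nx [k _ e]; apply: nx; exists k => //=.
    by rewrite e.
  exact: (bij_inj psiP.1).
- move=> k; apply: le_trans (isometry_atom_le (s k) Wmu).
  rewrite [leLHS](nuE _) [X in mu X <= _](_ : _ = [set s k])//.
  by apply/seteqP; split=> [x /(bij_inj psiP.1)|x ->].
Qed.

Lemma isometry_pushforward mu : W1 rho mu ->
  meas_eq (Phi mu) (fun A => mu (psi @^-1` A)).
Proof.
move=> Wmu.
have [nu [nuE _]] := probability_pushforward mu measurable_isometry.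
suff h : meas_eq (Phi mu) nu by move=> A mA; rewrite h// nuE.
apply: (meas_eq_of_dW1_approx hmetric hsep hborel) => e e0.
(* Half of [e], because the strict pointwise bound is integrated as a weak one. *)
have e20 : (0 < e / 2)%R by lra.
have [f [s [mf fe fs]]] := countable_range_approx hmetric hsep hborel e20.
have [Q [QE QI]] := probability_pushforward mu mf.
have costle : \int[mu]_x (rho x (f x))%:E < e%:E.
  apply: (@le_lt_trans _ _ (e / 2)%:E); last by rewrite lte_fin; lra.
  rewrite -[leRHS]mule1 -(probability_setT mu) -integral_cst//.
  apply: ge0_le_integral => //.
  - exact/measurable_EFinP/(measurable_metric_comp hmetric hsep hborel).
  - by move=> x _; rewrite lee_fin ltW.
have WQ : W1 rho Q.
  have [x xoo] := Wmu; exists x; rewrite QI//.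
  apply: (@le_lt_trans _ _ (\int[mu]_z ((rho z (f z))%:E + (rho z x)%:E))).
    apply: ge0_le_integral => //.
    - exact/measurable_EFinP/(measurable_metric_comp hmetric hsep hborel).
    - apply: emeasurable_funD => //.
      exact/measurable_EFinP/(measurable_metric_comp hmetric hsep hborel).
    - move=> z _; rewrite -EFinD lee_fin (rhoC z); exact: rho_triangle.
  rewrite ge0_integralD//; last first.
    exact/measurable_EFinP/(measurable_metric_comp hmetric hsep hborel).
  by rewrite lte_add_pinfty// (lt_trans costle)// ltry.
have PhiQ : forall A, measurable A -> Phi Q A = Q (psi @^-1` A).
  apply: (@isometry_pushforward_atomic _ s) => //.
  rewrite QE (_ : _ @^-1` _ = set0) ?measure0//.
  by apply/seteqP; split=> // x /= /(_ _); apply; have [k ->] := fs x; exists k.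
(* By the atomic case [Phi Q] is the push-forward of [Q] along [psi]. It is coupled with [nu] by the
   law of [(psi (f x), psi x)] under [mu], whose cost is that of [(x, f x)]. *)
exists (Phi Q); split.
  rewrite hiso//.
  have [||||pi [cpi E]] := @coupling_pushforward _ _ _ _ hmetric hsep hborel
    _ _ mu id f mu Q => //.
  by apply: le_lt_trans (dW1_le_cost cpi) _; rewrite E.
have [||A mA|A mA|pi [cpi E]] := @coupling_pushforward _ _ _ _ hmetric hsep
  hborel _ _ mu (psi \o f) psi (Phi Q) nu.
- exact: measurableT_comp measurable_isometry mf.
- exact: measurable_isometry.
- by rewrite PhiQ// QE.
- by rewrite nuE.
apply: le_lt_trans (dW1_le_cost cpi) _; rewrite E.
by under eq_integral do rewrite /= psiP.2 rhoC.
Qed.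

End Psi.
End Rigidity.

Theorem theorem4p6 (R : realType) (d : measure_display) (T : measurableType d)
  (rho : T -> T -> R)
  (hmetric : is_metric rho)
  (hcomplete : metric_complete rho)
  (hsep : metric_separable rho)
  (hstrict : strict_triangle rho)
  (hborel : @measurable d T = <<s rho_open rho >>)
  (Phi : probability T R -> probability T R)
  (hmaps : forall mu, W1 rho mu -> W1 rho (Phi mu))
  (hinj : forall mu nu, W1 rho mu -> W1 rho nu -> meas_eq (Phi mu) (Phi nu) -> meas_eq mu nu)
  (hsurj : forall nu, W1 rho nu -> exists2 mu, W1 rho mu & meas_eq (Phi mu) nu)
  (hiso : forall mu nu, W1 rho mu -> W1 rho nu ->
            dW1 rho (Phi mu) (Phi nu) = dW1 rho mu nu) :
  exists psi : T -> T, metric_isometry rho psi /\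
    forall mu, W1 rho mu ->
      meas_eq (Phi mu) (fun A => mu (psi @^-1` A)).
Proof.
have [psi [psi_iso psiE]] :=
  isometry_on_diracs hmetric hsep hborel hstrict hmaps hinj hsurj hiso.
exists psi; split=> // mu.
exact: (isometry_pushforward hmetric hsep hborel hstrict hmaps hiso psi_iso psiE).
Qed.
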